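(* Let $f$ be a contractive similitude on $\mathbb{R}$. (i) Let $\alpha,\beta>0$ with $\alpha\ne\beta$ and $\alpha+\beta<1$, and let $K_{\alpha,\beta}$ be the self-similar set generated by $\phi_1(x)=\alpha x$, $\phi_2(x)=\beta x+1-\beta$. If $f(K_{\alpha,\beta})\subset K_{\alpha,\beta}$, then there exists a finite word $\mathbf{i}\in\Omega_2^*$ such that $f(x)=\phi_{\mathbf{i}}(x)$ for all $x\in\mathbb{R}$. (ii) Let $m\ge2$ be an integer and $0<\beta<1/m$, and let $\Gamma_{\beta,m}$ be the self-similar set generated by \[ \phi_i(x)=\beta x+\frac{(i-1)(1-\beta)}{m-1},\qquad 1\le i\le m. \] If $f(\Gamma_{\beta,m})\subset\Gamma_{\beta,m}$, then there exists a finite word $\mathbf{i}\in\Omega_m^*$ such that $f(x)=\phi_{\mathbf{i}}(x)$ for all $x\in\mathbb{R}$ or $f(x)=\phi_{\mathbf{i}}(1-x)$ for all $x\in\mathbb{R}$.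
   Context: A contractive similitude on $\mathbb{R}$ is a map $f(x)=rx+t$ with $0<|r|<1$ and $t\in\mathbb{R}$. The self-similar set generated by contractive similitudes $\phi_1,\ldots,\phi_m$ is the unique non-empty compact set $K\subset\mathbb{R}$ with $K=\bigcup_{i=1}^m\phi_i(K)$. $\Omega_m^*$ is the set of all finite words over the alphabet $\{1,2,\ldots,m\}$, including the empty word. For $\mathbf{i}=i_1i_2\ldots i_n\in\Omega_m^*$, $\phi_{\mathbf{i}}:=\phi_{i_1}\circ\phi_{i_2}\circ\cdots\circ\phi_{i_n}$, and $\phi_{\emptyset}$ is the identity map. *)

(* Defs.v *)
From HB Require Import structures.
From mathcomp Require Import all_boot all_order all_algebra.
From mathcomp Require Import all_classical all_reals all_analysis.

Set Implicit Arguments.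
Unset Strict Implicit.
Unset Printing Implicit Defensive.

Import Order.TTheory GRing.Theory Num.Theory.
Import numFieldNormedType.Exports.

Local Open Scope classical_set_scope.
Local Open Scope ring_scope.

Definition contractive_similitude (R : realType) (f : R -> R) : Prop :=
  exists r t : R, 0 < `|r| /\ `|r| < 1 /\ forall x : R, f x = r * x + t.

(* For finitely many contractive similitudes phi, exactly one set K satisfies
   this (Hutchinson), so quantifying over such K speaks about "the"
   self-similar set. *)
Definition is_self_similar_set (R : realType) (m : nat)
    (phi : 'I_m -> R -> R) (K : set R) : Prop :=
  [/\ K !=set0, compact K & K = \bigcup_(i in [set: 'I_m]) (phi i @` K)].

(* [:: i1; ...; in] is sent to phi i1 \o ... \o phi in, and [::] to id. *)
Definition word_map (R : realType) (m : nat) (phi : 'I_m -> R -> R)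
    (w : seq 'I_m) : R -> R :=
  foldr (fun i g => phi i \o g) id w.

(* Letters are numbered from 0 : the letter k of 'I_m stands for k + 1 in
   {1, ..., m}. *)
Definition two_ratio_ifs (R : realType) (alpha beta : R) :
    'I_2 -> R -> R :=
  fun i x => if i == ord0 then alpha * x else beta * x + 1 - beta.

Definition equal_ratio_ifs (R : realType) (beta : R) (m : nat) :
    'I_m -> R -> R :=
  fun i x => beta * x + (i%:R * (1 - beta)) / (m%:R - 1).

(* Main.v *)
(* Both systems consist of pieces phi_0 [0, 1], ..., phi_(m-1) [0, 1] in [0, 1],
   consecutive ones being separated by gaps of one common length G.  Then every
   interval in [0, 1] longer than G meets the attractor K.  Strip from f as many
   maps phi_i on the left as possible: the ratio r of the remaining map g still
   satisfies |r| <= 1, and g K lies in no single piece, so it jumps over some gap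
   of length G.  The preimage of that gap under g has length G / |r| and misses
   K, hence |r| = 1, and g is the identity or the reflection x |-> 1 - x.  With
   two different ratios, K is not symmetric under the reflection. *)
Require Import Defs.
From HB Require Import structures.
From mathcomp Require Import all_boot all_order all_algebra.
From mathcomp Require Import all_classical all_reals all_analysis.
From mathcomp Require Import ring lra.

Set Implicit Arguments.
Unset Strict Implicit.
Unset Printing Implicit Defensive.

Import Order.TTheory GRing.Theory Num.Theory.
Import numFieldNormedType.Exports.

Local Open Scope classical_set_scope.
Local Open Scope ring_scope.

(** * Induction on scales *)

(** Each use of the step enlarges the scale by a factor of at least [1 / c > 1], so finitely many
    uses carry any [d > 0] past 1. This is the induction behind repeatedly undoing some [phi i]. *)
Lemma scale_ind (R : realType) (c : R) (P : R -> Prop) :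
  0 < c -> c < 1 ->
  (forall d, 1 < d -> P d) ->
  (forall d, 0 < d -> (forall d', d <= c * d' -> P d') -> P d) ->
  forall d, 0 < d -> P d.
Proof.
move=> c_gt0 c_lt1 Pbig Pstep d d_gt0.
have Ppow n : forall e, c ^+ n < e -> P e.
  elim: n => [|n IHn] e; first by rewrite expr0; exact: Pbig.
  move=> lt_e; apply: Pstep => [|e' le_e].
    by apply: lt_trans lt_e; rewrite exprn_gt0.
  by apply: IHn; rewrite -(ltr_pM2l c_gt0) -exprS; apply: lt_le_trans le_e.
have : c ^+ n @[n --> \oo] --> (0 : R).
  by apply: cvg_expr; rewrite ger0_norm // ltW.
move=> /cvgr_lt /(_ d d_gt0) [n _ /(_ n (leqnn n))]; exact: Ppow.
Qed.

(** * Systems with gaps of equal length *)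

(** Left end of the [k]-th piece, which has length [rho k]. At [k = m] it counts a fictitious gap
    after the last piece. *)
Definition piece_left (R : realType) (rho : nat -> R) (G : R) (k : nat) : R :=
  \sum_(i < k) (rho i + G).

(* [piece_left rho G m = 1 + G] says that the last piece ends at 1; the bound
   [rho k <= 1 - G] is automatic when [2 <= m]. *)
Record even_gap_ifs (R : realType) (m : nat) (rho : nat -> R) (G : R)
    (phi : 'I_m -> R -> R) : Prop := EvenGapIfs {
  gap_gt0 : 0 < G;
  ratio_gt0 : forall k, 0 < rho k;
  ratio_le : forall k, rho k <= 1 - G;
  piece_left_last : piece_left rho G m = 1 + G;
  ifsE : forall i x, phi i x = rho i * x + piece_left rho G i
}.

Section EvenGapIfs.
Variables (R : realType) (m : nat) (rho : nat -> R) (G : R).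
Variables (phi : 'I_m -> R -> R) (K : set R).
Hypothesis phi_even : even_gap_ifs rho G phi.
Hypothesis K_self_similar : is_self_similar_set phi K.

Local Notation a := (piece_left rho G).

Let G_gt0 : 0 < G. Proof. exact: gap_gt0 phi_even. Qed.
Let rho_gt0 k : 0 < rho k. Proof. exact: (ratio_gt0 phi_even). Qed.
Let rho_le k : rho k <= 1 - G. Proof. exact: (ratio_le phi_even). Qed.
Let rho_lt1 k : rho k < 1.
Proof. by apply: le_lt_trans (rho_le k) _; rewrite gtrBl G_gt0. Qed.

Let phiE i x : phi i x = rho i * x + a i. Proof. exact: (ifsE phi_even). Qed.

Let a0 : a 0 = 0. Proof. by rewrite /piece_left big_ord0. Qed.

Let aS k : a k.+1 = a k + rho k + G.
Proof. by rewrite /piece_left big_ord_recr /= addrA. Qed.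

Let am : a m = 1 + G. Proof. exact: piece_left_last phi_even. Qed.

Lemma piece_left_le k l : (k <= l)%N -> a k <= a l.
Proof.
have G0 := G_gt0.
elim: l => [|l IHl]; first by rewrite leqn0 => /eqP ->.
rewrite leq_eqVlt => /predU1P[->//|]; rewrite ltnS => /IHl le_k.
rewrite aS; have := rho_gt0 l; lra.
Qed.

Lemma piece_left_ge0 k : 0 <= a k.
Proof. by rewrite -a0 piece_left_le. Qed.

Lemma piece_right_le1 (i : 'I_m) : a i + rho i <= 1.
Proof. have := piece_left_le (ltn_ord i); rewrite aS am; lra. Qed.

(** A piece and the gap to its right form a cell [[a i, a i.+1)]; these cells tile [[0, 1 + G)]. *)
Lemma piece_containing u :
  0 <= u < 1 + G -> exists i : 'I_m, a i <= u /\ u < a i.+1.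
Proof.
rewrite -am => /andP[u_ge0].
have: (m <= m)%N by [].
elim: {1 3}m => [|k IHk] lt_km; first by rewrite a0 ltNge u_ge0.
case: (ltP u (a k)) => [lt_u _|le_u lt_u]; first exact: IHk (ltnW lt_km) lt_u.
by exists (Ordinal lt_km).
Qed.

Lemma self_similarP y : K y <-> exists i x, K x /\ y = phi i x.
Proof.
case: K_self_similar => _ _ {1}->; split => [[i _ [x Kx <-]]|[i [x [Kx ->]]]].
  by exists i, x.
by exists i => //; exists x.
Qed.

Lemma phi_in i x : K x -> K (phi i x).
Proof. by move=> Kx; apply/self_similarP; exists i, x. Qed.

Lemma m_gt0 : (0 < m)%N.
Proof.
have G0 := G_gt0.
rewrite lt0n; apply/eqP => m0; have := am; rewrite m0 a0; lra.
Qed.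

(** * Extreme points and density of the attractor *)

(** The maximum [b] of the compact set [K] is some [phi i y] with [y <= b], and [phi i] contracts
    and maps 1 to at most 1, so [b <= 1]. The last map fixes 1 and cannot move [b] up, so
    [b >= 1]. *)
Lemma self_similar_max : K 1 /\ forall x, K x -> x <= 1.
Proof.
case: K_self_similar => K0 cptK _.
have [b bK b_max] := compact_EVT_max K0 cptK (@continuous_subspaceT _ _ K id
  (fun x => cvg_id)).
have {}b_max x : K x -> x <= b by move=> Kx; apply: b_max; rewrite inE.
move: bK; rewrite inE => Kb.
have b_le1 : b <= 1.
  have /self_similarP[i [y [/b_max y_le bE]]] := Kb.
  have : rho i * y <= rho i * b by rewrite ler_pM2l.
  move: bE; rewrite phiE; have := piece_right_le1 i; have := rho_lt1 i.
  by move=> *; nra.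
suff bE : b = 1 by rewrite -bE.
have lt_m : (m.-1 < m)%N by rewrite prednK ?m_gt0.
have := phi_in (Ordinal lt_m) Kb; rewrite phiE /= => /b_max.
have := am; rewrite -{1}(prednK m_gt0) aS; have := rho_lt1 m.-1.
by move=> *; apply/eqP; rewrite eq_le b_le1 /=; nra.
Qed.

Lemma self_similar_min : K 0 /\ forall x, K x -> 0 <= x.
Proof.
case: K_self_similar => K0 cptK _.
have [b bK b_min] := compact_EVT_min K0 cptK (@continuous_subspaceT _ _ K id
  (fun x => cvg_id)).
have {}b_min x : K x -> b <= x by move=> Kx; apply: b_min; rewrite inE.
move: bK; rewrite inE => Kb.
have b_ge0 : 0 <= b.
  have /self_similarP[i [y [/b_min y_ge bE]]] := Kb.
  have : rho i * b <= rho i * y by rewrite ler_pM2l.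
  move: bE; rewrite phiE; have := piece_left_ge0 i; have := rho_lt1 i.
  by move=> *; nra.
suff bE : b = 0 by rewrite -{1}bE; split=> // x /b_min; rewrite bE.
have := phi_in (Ordinal m_gt0) Kb; rewrite phiE /= => /b_min.
rewrite a0; have := rho_lt1 0.
by move=> *; apply/eqP; rewrite eq_le b_ge0 andbT; nra.
Qed.

Lemma phi0_in (i : 'I_m) : K (a i).
Proof. by have [/(phi_in i)] := self_similar_min; rewrite phiE mulr0 add0r. Qed.

Lemma phi1_in (i : 'I_m) : K (a i + rho i).
Proof.
by have [/(phi_in i)] := self_similar_max; rewrite phiE mulr1 addrC.
Qed.

(** Either an end of a piece lies strictly between [u] and [v], or both lie in one piece; then
    undoing [phi i] gives a longer interval of [[0, 1]], and induction on the length applies. *)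
Lemma self_similar_dense u v :
  0 <= u -> v <= 1 -> G < v - u -> exists x, [/\ K x, u < x & x < v].
Proof.
have G0 := G_gt0.
suff main d : 0 < d -> forall u v, v - u = d -> 0 <= u -> v <= 1 -> G < v - u ->
    exists x, [/\ K x, u < x & x < v].
  move=> u0 v1 uv; apply: (main (v - u)) => //; exact: lt_trans uv.
have [c_gt0 c_lt1] : 0 < 1 - G /\ 1 - G < 1.
  by split; [exact: lt_le_trans (rho_gt0 0) (rho_le 0)|lra].
move: d; apply: (scale_ind c_gt0 c_lt1) => [d d1 {}u {}v|]; first lra.
move=> d d0 IH {}u {}v uvd u0 v1 uv.
have [|i [au ua]] := @piece_containing u; first by lra.
have ri := rho_gt0 i; have ri_le := rho_le i.
(* If [u] lies in the gap after piece [i], the next piece starts at most [G] further on, hence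
   before [v]. Piece [i] is not the last one, as [u < 1]. *)
case: (ltP u (a i + rho i)) => ur; last first.
  have lt_i : (i.+1 < m)%N.
    rewrite ltn_neqAle ltn_ord andbT; apply/eqP => im.
    by have := aS i; rewrite im am; lra.
  by exists (a i.+1); split=> //; [exact: (phi0_in (Ordinal lt_i))|rewrite aS; lra].
case: (ltP (a i + rho i) v) => rv; first by exists (a i + rho i); split=> //; exact: phi1_in.
have dE : (v - a i) / rho i - (u - a i) / rho i = d / rho i.
  by rewrite -uvd; field; rewrite gt_eqF.
have [||||x [Kx ux xv]] := IH (d / rho i) _ _ _ dE.
- by rewrite mulrA ler_pdivlMr // mulrC ler_pM2r.
- by rewrite divr_ge0 ?subr_ge0 // ltW.
- by rewrite ler_pdivrMr //; lra.
- by rewrite dE ltr_pdivlMr //; nra.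
move: ux xv; rewrite ltr_pdivrMr // ltr_pdivlMr // => ux xv.
exists (phi i x); split; first exact: phi_in.
  by rewrite phiE; lra.
by rewrite phiE; lra.
Qed.

Lemma phi_bounds (i : 'I_m) x : K x -> a i <= phi i x <= a i + rho i.
Proof.
move=> Kx; have [_ /(_ _ Kx) x0] := self_similar_min.
have [_ /(_ _ Kx) x1] := self_similar_max.
by rewrite phiE; have := rho_gt0 i; nra.
Qed.

Lemma notin_gap (i : 'I_m) x : K x -> a i + rho i < x -> a i.+1 <= x.
Proof.
have G0 := G_gt0.
move=> /self_similarP[j [y [Ky ->]]]; have /andP[lo hi] := phi_bounds j Ky.
case: (leqP j i) => [ji|ij _]; last by apply: le_trans lo; exact: piece_left_le.
move=> h; have := piece_left_le ji.
move: ji; rewrite leq_eqVlt => /predU1P[ji|ji]; first by rewrite ji in hi; lra.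
by have := piece_left_le ji; rewrite aS; have := rho_gt0 i; lra.
Qed.

Lemma in_piece (i : 'I_m) x :
  K x -> a i <= x <= a i + rho i -> exists2 y, K y & x = phi i y.
Proof.
have G0 := G_gt0.
move=> /self_similarP[j [y [Ky ->]]]; have /andP[lo hi] := phi_bounds j Ky.
case: (ltngtP i j) => [ij|ji|/val_inj ->].
- by have := piece_left_le ij; rewrite aS; lra.
- by have := piece_left_le ji; rewrite aS; lra.
by exists y.
Qed.

(** * Similitudes mapping the attractor into itself *)

(** If [|r| < 1], the preimage of the gap lies between [x] and [y], hence in [[0, 1]], and is longer
    than [G]. So it contains a point of [K], whose image would fall into the gap. *)
Lemma similitude_jumping_gap r t (i : 'I_m) x y :
  0 < `|r| -> `|r| <= 1 -> (forall z, K z -> K (r * z + t)) ->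
  K x -> K y -> r * x + t <= a i + rho i -> a i.+1 <= r * y + t -> `|r| = 1.
Proof.
have G0 := G_gt0.
move=> r0 r1 gK Kx Ky; rewrite aS => gx gy; apply/eqP; rewrite eq_le r1 /=.
rewrite leNgt; apply/negP => r_lt1.
have [_ K0] := self_similar_min; have [_ K1] := self_similar_max.
have [[x0 x1] [y0 y1]] : (0 <= x /\ x <= 1) /\ (0 <= y /\ y <= 1).
  by split; split; [exact: K0|exact: K1|exact: K0|exact: K1].
have nogap z : K z -> a i + rho i < r * z + t -> a i + rho i + G <= r * z + t.
  by move=> Kz; rewrite -aS; apply: notin_gap; apply: gK.
case: (ltgtP r 0) => [r_lt0|r_gt0|r_eq0]; last by rewrite r_eq0 normr0 ltxx in r0.
(* For [r < 0] the preimage has its ends swapped. *)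
- move: r_lt1; rewrite ltr0_norm // => r_lt1.
  have := @self_similar_dense ((a i + rho i + G - t) / r) ((a i + rho i - t) / r).
  case=> [|||z []].
  + by rewrite ler_ndivlMr //; nra.
  + by rewrite ler_ndivrMr //; nra.
  + rewrite -mulrBl ltr_ndivlMr //; nra.
  rewrite ltr_ndivrMr // ltr_ndivlMr // => Kz h1 h2.
  by have := nogap z Kz; lra.
move: r_lt1; rewrite gtr0_norm // => r_lt1.
have := @self_similar_dense ((a i + rho i - t) / r) ((a i + rho i + G - t) / r).
case=> [|||z []].
- by rewrite ler_pdivlMr //; nra.
- by rewrite ler_pdivrMr //; nra.
- rewrite -mulrBl ltr_pdivlMr //; nra.
rewrite ltr_pdivrMr // ltr_pdivlMr // => Kz h1 h2.
by have := nogap z Kz; lra.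
Qed.

(** Compare the pieces containing the images of 0 and 1. If they agree, monotonicity puts the image
    of all of [K] in that piece; otherwise the gap after the left one of the two is jumped. *)
Lemma similitude_piece_or_isometry r t :
  0 < `|r| -> `|r| <= 1 -> (forall z, K z -> K (r * z + t)) ->
  (exists i, forall z, K z -> exists2 y, K y & r * z + t = phi i y) \/
  `|r| = 1.
Proof.
move=> r0 r1 gK; have [K0 K_ge0] := self_similar_min.
have [K1 K_le1] := self_similar_max.
have /self_similarP[i [x [Kx xE]]] := gK _ K0.
have /self_similarP[j [y [Ky yE]]] := gK _ K1.
have := phi_bounds i Kx; have := phi_bounds j Ky; rewrite -xE -yE.
move=> /andP[yl yr] /andP[xl xr].
case: (ltngtP i j) => [ij|ji|/val_inj ij].
- right; apply: (similitude_jumping_gap r0 r1 gK K0 K1 xr).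
  by apply: le_trans yl; exact: piece_left_le.
- right; apply: (similitude_jumping_gap r0 r1 gK K1 K0 yr).
  by apply: le_trans xl; exact: piece_left_le.
left; exists i => z Kz; apply: in_piece; first exact: gK.
rewrite -ij in yl yr; have := K_ge0 z Kz; have := K_le1 z Kz => z1 z0.
by apply/andP; case: (leP 0 r) => hr; split; nra.
Qed.

(** Induction on [|r|]: stripping [phi i] divides [r] by [rho i <= 1 - G]. The bound [|r| <= 1]
    includes isometries because the stripping ends at one. The reflected case records the symmetry
    of [K], which unequal ratios will contradict. *)
Lemma similitude_word_map r t :
  0 < `|r| -> `|r| <= 1 -> (forall z, K z -> K (r * z + t)) ->
  exists w, (forall x, r * x + t = word_map phi w x) \/
    (forall x, K x -> K (1 - x)) /\
    (forall x, r * x + t = word_map phi w (1 - x)).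
Proof.
have G0 := G_gt0.
suff main d : 0 < d -> forall r t, `|r| = d -> d <= 1 ->
    (forall z, K z -> K (r * z + t)) ->
    exists w, (forall x, r * x + t = word_map phi w x) \/
      (forall x, K x -> K (1 - x)) /\
      (forall x, r * x + t = word_map phi w (1 - x)).
  by move=> r0; exact: main.
move: d; have [c_gt0 c_lt1] : 0 < 1 - G /\ 1 - G < 1.
  by split; [exact: lt_le_trans (rho_gt0 0) (rho_le 0)|lra].
apply: (scale_ind c_gt0 c_lt1) => [d d1 {}r {}t _|]; first lra.
move=> d d0 IH {}r {}t rd d1 gK.
have [K0 K_ge0] := self_similar_min; have [K1 K_le1] := self_similar_max.
have [||[i gi]|r1] := similitude_piece_or_isometry _ _ gK; rewrite ?rd //.
  have ri := rho_gt0 i; have ri_le := rho_le i.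
  have rE : `|r / rho i| = d / rho i.
    by rewrite normrM rd normfV (gtr0_norm ri).
  have gE z : r / rho i * z + (t - a i) / rho i = (r * z + t - a i) / rho i.
    by field; rewrite gt_eqF.
  have g'K z : K z -> K (r / rho i * z + (t - a i) / rho i).
    move=> /gi[y Ky]; rewrite gE => ->; rewrite phiE addrK mulrC mulKf //.
    by rewrite gt_eqF.
  (* The stripped map sends 0 and 1 into [[0, 1]], and its ratio is the difference of these two
     values. *)
  have d'1 : d / rho i <= 1.
    have := K_ge0 _ (g'K _ K0); have := K_le1 _ (g'K _ K1).
    have := K_ge0 _ (g'K _ K1); have := K_le1 _ (g'K _ K0).
    by rewrite mulr1 mulr0 -rE ler_norml => *; lra.
  have [|w w_spec] := IH (d / rho i) _ _ _ rE d'1 g'K.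
    by rewrite mulrA ler_pdivlMr // mulrC ler_pM2r.
  have unstrip x : r * x + t = phi i (r / rho i * x + (t - a i) / rho i).
    by rewrite phiE; field; rewrite gt_eqF.
  by exists (i :: w); case: w_spec => [h|[symK h]]; [left|right; split=> //] => x;
    rewrite unstrip h.
(* For an isometry, the images of 0 and 1 both lie in [[0, 1]], which forces [t = 0] if [r = 1] and
   [t = 1] if [r = -1]. *)
exists [::] => /=.
have := K_ge0 _ (gK _ K0); have := K_le1 _ (gK _ K1).
have := K_ge0 _ (gK _ K1); have := K_le1 _ (gK _ K0); rewrite mulr0 mulr1 add0r.
move: r1; case: (ler0P r) => _ rE t1 rt0 rt1 t0; last by left=> x; rewrite rE; lra.
have [{}rE tE] : r = -1 /\ t = 1 by lra.
right; split=> x; last by rewrite /= rE tE; lra.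
by move=> /gK; rewrite rE tE mulN1r addrC.
Qed.

End EvenGapIfs.

(** * The two concrete systems *)

Lemma two_ratio_even_gap (R : realType) (alpha beta : R) :
  0 < alpha -> 0 < beta -> alpha + beta < 1 ->
  even_gap_ifs (fun k => if k == 0%N then alpha else beta) (1 - alpha - beta)
    (two_ratio_ifs alpha beta).
Proof.
move=> a0 b0 ab; split.
- lra.
- by case.
- by case=> [|k] /=; lra.
- by rewrite /piece_left !big_ord_recl big_ord0 /=; lra.
case=> [[|[|//]] lt_i] x; rewrite /two_ratio_ifs /piece_left -val_eqE /=.
- by rewrite big_ord0 addr0.
- by rewrite big_ord_recl big_ord0 /=; lra.
Qed.

(** The pieces have total length [m * beta], and the [m - 1] gaps share the rest; so
    [beta + G = (1 - beta) / (m - 1)] is the step between left ends. *)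
Lemma equal_ratio_even_gap (R : realType) (beta : R) (m : nat) :
  (2 <= m)%N -> 0 < beta -> beta < 1 / m%:R ->
  even_gap_ifs (fun=> beta) ((1 - m%:R * beta) / (m%:R - 1))
    (@equal_ratio_ifs R beta m).
Proof.
move=> m2 b0; have m2R : 2 <= m%:R :> R by rewrite ler_nat.
have m0 : 0 < m%:R :> R by lra.
have m1 : 0 < m%:R - 1 :> R by lra.
rewrite ltr_pdivlMr // => bm.
have leftE k : piece_left (fun=> beta) ((1 - m%:R * beta) / (m%:R - 1)) k =
    k%:R * (1 - beta) / (m%:R - 1).
  rewrite /piece_left sumr_const card_ord -mulr_natl; field.
  by rewrite gt_eqF.
split=> //.
- by rewrite divr_gt0 //; lra.
- move=> _; rewrite lerBrDr -lerBrDl ler_pdivrMr //; nra.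
- by rewrite leftE; field; rewrite gt_eqF.
by move=> i x; rewrite leftE.
Qed.

(** * Asymmetry for two different ratios *)

(** A symmetric [K] would also miss the reflected gap from [beta] to [1 - alpha]. This gap lies in
    the larger piece, and undoing the map of that piece makes it longer than [G], against
    [self_similar_dense]. *)
Lemma two_ratio_not_symmetric (R : realType) (alpha beta : R) (K : set R) :
  0 < alpha -> 0 < beta -> alpha + beta < 1 -> alpha <> beta ->
  is_self_similar_set (two_ratio_ifs alpha beta) K ->
  ~ (forall x, K x -> K (1 - x)).
Proof.
move=> a0 b0 ab /eqP neq_ab K_ss symK.
have even := two_ratio_even_gap a0 b0 ab.
have K0 := (self_similar_min even K_ss).1.
have K1 := (self_similar_max even K_ss).1.
pose i0 : 'I_2 := ord0; pose i1 : 'I_2 := ord_max.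
have phi0 x : K x -> K (alpha * x) by exact: (phi_in K_ss i0).
have phi1 x : K x -> K (beta * x + 1 - beta) by exact: (phi_in K_ss i1).
have gap x : K x -> alpha < x -> 1 - beta <= x.
  move=> Kx; have := notin_gap even K_ss (i := i0) Kx.
  by rewrite /piece_left big_ord0 big_ord_recl big_ord0 /=; lra.
have gap' x : K x -> x <= beta \/ 1 - alpha <= x.
  by move=> /symK/gap; case: (leP x beta); [left|right; lra].
case: (ltgtP alpha beta) neq_ab => [lt_ab|lt_ba|//] _.
(* The reflected gap starts inside the right piece: [beta] is in [K], as the mirror image of
   [1 - beta], and exceeds [alpha]. *)
- have beta_ge : 1 - beta <= beta.
    apply: gap => //; rewrite -[beta](subKr 1); apply: symK.
    by have := phi1 0 K0; rewrite mulr0 add0r.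
  have := @self_similar_dense _ _ _ _ _ _ even K_ss
    ((beta - (1 - beta)) / beta) ((1 - alpha - (1 - beta)) / beta).
  case=> [|||x []].
  + by rewrite divr_ge0 // ?subr_ge0 // ltW.
  + by rewrite ler_pdivrMr //; lra.
  + by rewrite -mulrBl ltr_pdivlMr //; nra.
  rewrite ltr_pdivrMr // ltr_pdivlMr // => /phi1/gap'; lra.
(* The reflected gap ends inside the left piece: otherwise [1 - alpha], a point of [K], would lie in
   the original gap. *)
- have alpha_ge : 1 - alpha <= alpha.
    rewrite leNgt; apply/negP => lt_alpha.
    have /gap/(_ lt_alpha) : K (1 - alpha); last lra.
    by apply: symK; have := phi0 1 K1; rewrite mulr1.
  have := @self_similar_dense _ _ _ _ _ _ even K_ss
    (beta / alpha) ((1 - alpha) / alpha).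
  case=> [|||x []].
  + by rewrite divr_ge0 // ltW.
  + by rewrite ler_pdivrMr //; lra.
  + by rewrite -mulrBl ltr_pdivlMr //; nra.
  rewrite ltr_pdivrMr // ltr_pdivlMr // => /phi0/gap'; lra.
Qed.

(** * Similitudes of both families of attractors *)

Theorem corollary1p3 (R : realType) (f : R -> R)
    (hf : contractive_similitude f) :
  (forall (alpha beta : R), 0 < alpha -> 0 < beta -> alpha <> beta ->
     alpha + beta < 1 ->
     forall K : set R, is_self_similar_set (two_ratio_ifs alpha beta) K ->
     f @` K `<=` K ->
     exists w : seq 'I_2,
       forall x : R, f x = word_map (two_ratio_ifs alpha beta) w x)
  /\
  (forall (m : nat) (beta : R), (2 <= m)%N -> 0 < beta -> beta < 1 / m%:R ->
     forall Gamma : set R,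
       is_self_similar_set (@equal_ratio_ifs R beta m) Gamma ->
     f @` Gamma `<=` Gamma ->
     exists w : seq 'I_m,
       (forall x : R, f x = word_map (@equal_ratio_ifs R beta m) w x) \/
       (forall x : R, f x = word_map (@equal_ratio_ifs R beta m) w (1 - x))).
Proof.
case: hf => r [t [r0 [/ltW r1 fE]]].
have fK K : f @` K `<=` K -> forall z, K z -> K (r * z + t).
  by move=> fK z Kz; rewrite -fE; apply: fK; exists z.
split=> [alpha beta a0 b0 neq_ab ab K K_ss /fK{}fK|m beta m2 b0 bm K K_ss /fK{}fK].
- have even := two_ratio_even_gap a0 b0 ab.
  have [w [wE|[symK _]]] := similitude_word_map even K_ss r0 r1 fK.
    by exists w => x; rewrite fE.
  by have := two_ratio_not_symmetric a0 b0 ab neq_ab K_ss symK.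
have even := equal_ratio_even_gap m2 b0 bm.
have [w [wE|[_ wE]]] := similitude_word_map even K_ss r0 r1 fK.
  by exists w; left=> x; rewrite fE.
by exists w; right=> x; rewrite fE.
Qed.
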